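(* In the setting of the context, assume $\sum_{i=0}^N\mu_i<\infty$ and let $\lambda_1=\inf\{D(f):\mu(f)=0,\ \mu(f^2)=1\}$. Then $$(4\delta)^{-1}\le\eta_1^{-1}\le\lambda_1\le\bar\eta_1^{-1},$$ where $\delta=\sup_{1\le n\in E}\big(\sum_{i=1}^n\frac1{\mu_ia_i}\big)\mu[n,N]$, $$\eta_1=\sup_{1\le i\in E}\big(\sqrt{\varphi_i}+\sqrt{\varphi_{i-1}}\,\big)\Big[\psi_i-\psi_1\frac{\mu[i,N]}{\mu[0,N]}\Big],\qquad \psi_i=\sum_{j=i}^N\mu_j\sqrt{\varphi_j},$$ $$\bar\eta_1=\sup_{1\le m\in E}\frac1{\varphi_m}\Big[\sum_{1\le k\in E}\mu_k\varphi_{k\wedge m}^2-\frac1{\mu[0,N]}\Big(\sum_{1\le k\in E}\mu_k\varphi_{k\wedge m}\Big)^2\Big]$$ $$=\sup_{1\le m\in E}\Big\{\frac1{\varphi_m}\Big[\sum_{1\le k\le m-1}\mu_k\varphi_k^2-\frac1{\mu[0,N]}\Big(\sum_{1\le k\le m-1}\mu_k\varphi_k\Big)^2\Big]+\frac{\mu[m,N]}{\mu[0,N]}\Big[\varphi_m\,\mu[0,m-1]-2\sum_{1\le k\le m-1}\mu_k\varphi_k\Big]\Big\}.$$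
   Context: $E=\{i\in\mathbb Z:0\le i<N+1\}$, $1\le N\le\infty$; birth rates $b_i>0$ for $0\le i<N$ and $b_N=0$ if $N<\infty$; death rates $a_i>0$ for $1\le i\in E$, $a_0=0$. $\mu_0=1$, $\mu_n=\frac{b_0\cdots b_{n-1}}{a_1\cdots a_n}$; $\mu(f)=\sum_{i\in E}\mu_if_i$; $\mu[p,q]=\sum_{p\le i\le q,\,i\in E}\mu_i$. $D(f)=\sum_{1\le i<N+1}\mu_ia_i(f_i-f_{i-1})^2$ with domain $\{f\in L^2(\mu):D(f)<\infty\}$. $\varphi_0=0$, $\varphi_i=\sum_{0\le j\le i-1}(\mu_jb_j)^{-1}$ for $1\le i\in E$. Conventions: $1/\infty=0$; if $\psi_1=\infty$ then $\eta_1:=\infty$. *)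

(* Defs.v *)
From HB Require Import structures.
From mathcomp Require Import all_boot all_order all_algebra.
From mathcomp Require Import all_classical all_reals all_analysis.
Set Implicit Arguments.
Unset Strict Implicit.
Unset Printing Implicit Defensive.
Import Order.TTheory GRing.Theory Num.Theory.
Local Open Scope classical_set_scope.
Local Open Scope ring_scope.

(* Elements of {0, 1, 2, ..., oo} are encoded in [option nat], [None] being oo. *)
Definition le_oo (i : nat) (q : option nat) : bool :=
  if q is Some n then (i <= n)%N else true.

Definition lt_oo (i : nat) (q : option nat) : bool :=
  if q is Some n then (i < n)%N else true.

Section BirthDeath.
Context {R : realType}.
(* The state space is E = {i | le_oo i N}; [a] are the death rates and [b] the
   birth rates.  Functions on E are represented by functions on nat, whose
   values outside E are never used. *)
Variables (N : option nat) (a b : nat -> R).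

Definition mu (n : nat) : R :=
  (\prod_(0 <= j < n) b j) / (\prod_(1 <= j < n.+1) a j).

(* mu[p, q], for q a natural number or oo *)
Definition mu_itv (p : nat) (q : option nat) : \bar R :=
  (\sum_(p <= i <oo | le_oo i N && le_oo i q) (mu i)%:E)%E.

(* mu(f).  When mu is finite and f is in L^2(mu), the series converges
   absolutely. *)
Definition mu_fun (f : nat -> R) : \bar R :=
  (\sum_(0 <= i <oo | le_oo i N) (mu i * f i)%:E)%E.

Definition dirichlet (f : nat -> R) : \bar R :=
  (\sum_(1 <= i <oo | le_oo i N) (mu i * a i * (f i - f i.-1) ^+ 2)%:E)%E.

Definition dirichlet_domain : set (nat -> R) :=
  [set f | (mu_fun (fun i => (f i ^+ 2)%R) < +oo)%E /\ (dirichlet f < +oo)%E].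

Definition lambda1 : \bar R :=
  ereal_inf [set dirichlet f | f in
    [set f | [/\ dirichlet_domain f, mu_fun f = 0%E
               & mu_fun (fun i => (f i ^+ 2)%R) = 1%E]]].

Definition phi (i : nat) : R := \sum_(0 <= j < i) (mu j * b j)^-1.

Definition psi (i : nat) : \bar R :=
  (\sum_(i <= j <oo | le_oo j N) (mu j * Num.sqrt (phi j))%:E)%E.

(* {i in E | 1 <= i} *)
Definition E1 : set nat := [set i | (1 <= i)%N /\ le_oo i N].

Definition delta : \bar R :=
  ereal_sup [set ((\sum_(1 <= i < n.+1) (mu i * a i)^-1)%:E * mu_itv n N)%E
            | n in E1].

Definition eta1 : \bar R :=
  if psi 1 == +oo%E then +oo%E else
  ereal_sup [set ((Num.sqrt (phi i) + Num.sqrt (phi i.-1))%:E *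
                  (psi i - psi 1 * (mu_itv i N / mu_itv 0 N)))%E
            | i in E1].

Definition etabar1 : \bar R :=
  ereal_sup [set ((phi m)^-1%:E *
      ((\sum_(1 <= k <oo | le_oo k N) (mu k * phi (minn k m) ^+ 2)%:E)
       - (mu_itv 0 N)^-1 *
         (\sum_(1 <= k <oo | le_oo k N) (mu k * phi (minn k m))%:E) ^+ 2))%E
    | m in E1].

Definition etabar1_explicit : \bar R :=
  ereal_sup [set ((phi m)^-1%:E *
      ((\sum_(1 <= k < m) mu k * phi k ^+ 2)%:E
       - (mu_itv 0 N)^-1 * ((\sum_(1 <= k < m) mu k * phi k) ^+ 2)%:E)
      + mu_itv m N / mu_itv 0 N *
        ((phi m)%:E * mu_itv 0 (Some m.-1)
         - (2 * \sum_(1 <= k < m) mu k * phi k)%:E))%E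
    | m in E1].

End BirthDeath.

(* Main.v *)
Require Import Defs.
From mathcomp Require Import all_boot all_order all_algebra.
From mathcomp Require Import ring lra.
From mathcomp Require Import all_classical all_reals all_analysis.
Set Implicit Arguments.
Unset Strict Implicit.
Unset Printing Implicit Defensive.
Import Order.TTheory GRing.Theory Num.Theory.
Import numFieldNormedType.Exports.
Local Open Scope classical_set_scope.
Local Open Scope ring_scope.

(* Let [S_k] and [W_k] be the sums over indices < k of [mu] and [mu * sqrt phi],
   with totals [Z] and [Psi]; the i-th term of [eta1] is
   (sqrt phi_i + sqrt phi_(i-1)) (S_i Psi - W_i Z) / Z.
   - Lower bound for [lambda1]: expand [Z mu(f^2) - mu(f)^2] as a sum over i < j
     of mu_i mu_j (f_j - f_i)^2 and apply Cauchy-Schwarz along the path from i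
     to j with weights the increments of [sqrt phi].  Exchanging sums, the edge
     (k-1, k) receives mu_k a_k (f_k - f_(k-1))^2 times Z times the k-th term
     of [eta1].
   - [eta1 <= 4 delta]: the tail of the series of mu_j sqrt phi_j from i on is at
     most 2 delta / sqrt phi_i, by summation by parts.
   - Upper bound for [lambda1]: test with the centred and normalized function
     phi_(k /\ m), whose energy is phi_m before normalization. *)

(** * Extended series as real limits *)

Section Series.
Context {R : realType}.
Implicit Types (u : nat -> R) (P : pred nat).

Lemma eseries_EFin u P p (s : R) : (forall i, ~~ P i -> u i = 0) ->
  series u @ \oo --> s ->
  (\sum_(p <= i <oo | P i) (u i)%:E)%E = (s - series u p)%:E.
Proof.
move=> u0 us; apply/cvg_lim => //.
have : EFin \o (series u - cst (series u p)) @ \oo --> (s - series u p)%:E.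
  by apply: cvg_EFin; [exact: nearW | apply: cvgB => //; exact: cvg_cst].
apply: cvg_trans; apply: near_eq_cvg; near=> n => /=.
have pn : (p <= n)%N by near: n; exact: nbhs_infty_ge.
rewrite !fctE sub_series_geq // -sumEFin [RHS]big_mkcond /=.
by apply: eq_bigr => i _; case: ifPn => // /u0 ->.
Unshelve. all: by end_near. Qed.

(** The partial sums are monotone and bounded by the head up to [p] plus the finite value of the
    series. *)
Lemma nneseries_lty_cvg u P p : (forall i, 0 <= u i) ->
  (forall i, ~~ P i -> u i = 0) ->
  (\sum_(p <= i <oo | P i) (u i)%:E < +oo)%E -> cvgn (series u).
Proof.
move=> u_ge0 u0 fin.
have nd : nondecreasing_seq (series u).
  move=> i j ij; rewrite -subr_ge0 sub_series_geq //.
  by apply: sumr_ge0.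
apply: nondecreasing_is_cvgn => //.
have finum : (\sum_(p <= i <oo | P i) (u i)%:E)%E \is a fin_num.
  rewrite ge0_fin_numE //; apply: nneseries_ge0 => i _ _.
  by rewrite lee_fin.
exists (series u p + fine (\sum_(p <= i <oo | P i) (u i)%:E)%E) => _ [n _ <-].
apply: (le_trans (nd n (n + p)%N (leq_addr _ _))).
rewrite -lerBlDl sub_series_geq ?leq_addl // -lee_fin fineK // -sumEFin.
rewrite (eq_bigr (fun i => if P i then (u i)%:E else 0%E)); last first.
  by move=> i _; case: ifPn => // /u0 ->.
rewrite -big_mkcond /=; apply: nneseries_lim_ge => i _ _.
by rewrite lee_fin.
Qed.

(** * Cauchy-Schwarz along paths and the finite variance inequality *)

(** Exchange of summation on the triangle [i <= k < n]: a sum over edges becomes a sum over the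
    starting points of paths to [n]. *)
Lemma triangular_sum_exchange (c y : nat -> R) n :
  \sum_(0 <= k < n) c k * series y k.+1 =
  \sum_(0 <= i < n) y i * \sum_(i <= k < n) c k.
Proof.
elim: n => [|n IH]; first by rewrite !big_geq.
rewrite big_nat_recr //= IH.
rewrite (eq_big_nat _ _ (F1 := fun i => y i * \sum_(i <= k < n.+1) c k)
  (F2 := fun i => y i * (\sum_(i <= k < n) c k) + y i * c n)); last first.
  by move=> i /andP[_ ilen]; rewrite big_nat_recr //= mulrDr.
rewrite big_split /= big_nat_recr //= (big_geq (leqnn n)) mulr0 addr0.
by rewrite -mulr_suml mulrC /series /=.
Qed.

Lemma cauchy_schwarz_add (x y A B u c : R) :
  0 <= A -> 0 <= B -> 0 <= u -> 0 <= c ->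
  x ^+ 2 <= A * B -> y ^+ 2 = u * c -> (x + y) ^+ 2 <= (A + u) * (B + c).
Proof.
move=> A0 B0 u0 c0 xAB yuc.
suff : 2 * (x * y) <= A * c + u * B by nra.
apply: (le_trans (ler_norm _)).
(* Arithmetic-geometric mean inequality, compared after squaring: [4 * (A * B) * (u * c)] is at most
   [(A * c + u * B) ^+ 2]. *)
rewrite -ler_sqr ?nnegrE ?addr_ge0 ?mulr_ge0 // real_normK ?num_real //.
rewrite !exprMn yuc.
have : x ^+ 2 * (u * c) <= A * B * (u * c) by rewrite ler_wpM2r ?mulr_ge0.
have := sqr_ge0 (A * c - u * B).
by nra.
Qed.

(** Cauchy-Schwarz with the factorization of each squared increment as hypothesis. No division
    occurs, so [w] may have zero increments. *)
Lemma cauchy_schwarz_telescope (g w c : nat -> R) i j : (i <= j)%N ->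
  (forall k, (k < j)%N -> [/\ w k <= w k.+1, 0 <= c k &
    (g k.+1 - g k) ^+ 2 = (w k.+1 - w k) * c k]) ->
  (g j - g i) ^+ 2 <= (w j - w i) * \sum_(i <= k < j) c k.
Proof.
(* The induction must also carry the signs of both factors, which [cauchy_schwarz_add] requires. *)
move=> le_ij; suff : (forall k, (k < j)%N -> [/\ w k <= w k.+1, 0 <= c k &
    (g k.+1 - g k) ^+ 2 = (w k.+1 - w k) * c k]) ->
  [/\ w i <= w j, 0 <= \sum_(i <= k < j) c k &
  (g j - g i) ^+ 2 <= (w j - w i) * \sum_(i <= k < j) c k].
  by move=> + H => /(_ H)[].
elim: j le_ij => [|j IH] le_ij H.
  by move: le_ij; rewrite leqn0 => /eqP ->; rewrite big_geq // !subrr expr0n mul0r.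
move: le_ij; rewrite leq_eqVlt => /predU1P[->|].
  by rewrite big_geq // !subrr expr0n mul0r.
rewrite ltnS => le_ij; rewrite big_nat_recr //=.
have [wij c_ge0 gij] := IH le_ij (fun k kj => H k (ltnW kj)).
have [wj cj gj] := H j (ltnSn j).
split; [exact: le_trans wj | exact: addr_ge0 |].
rewrite -(subrKC (g j) (g j.+1)) -(subrKC (w j) (w j.+1)).
rewrite ![_ + _ - _ i]addrAC.
by apply: cauchy_schwarz_add => //; rewrite subr_ge0.
Qed.

(* The two summands are the variance of [g] and the sum over [i < k < j] of
   [m i * m j * (w j - w i) * c k], in closed form. *)
Lemma variance_le_flow (m w g c : nat -> R) n : (forall i, 0 <= m i) ->
  (forall i j, (i < j)%N -> 0 < m j ->
    (g j - g i) ^+ 2 <= (w j - w i) * \sum_(i <= k < j) c k) ->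
  series m n * series (fun i => m i * g i ^+ 2) n
    - series (fun i => m i * g i) n ^+ 2 <=
  \sum_(0 <= k < n) c k *
    (series m k.+1 * series (fun i => m i * w i) n
     - series (fun i => m i * w i) k.+1 * series m n).
Proof.
move=> m_ge0 CS; set mw := series (fun i => m i * w i).
elim: n => [|n IH].
  by rewrite /series /= !big_geq // mul0r expr0n subr0.
rewrite !seriesSr big_nat_recr //= -/mw.
(* At [k = n] both products in the bracket coincide, so the new last edge contributes nothing. *)
rewrite [X in _ <= _ + X](_ : _ = 0) ?addr0; last first.
  by rewrite !seriesSr /mw !seriesSr; ring.
(* Adding the point [n] raises the [k]-th bracket by [m n] times the sum over [i <= k] of
   [m i * (w n - w i)]. *)
rewrite (eq_bigr (fun k => c k * (series m k.+1 * mw n - mw k.+1 * series m n)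
   + m n * (c k * series (fun i => m i * (w n - w i)) k.+1))); last first.
  move=> k _.
  have -> : series (fun i => m i * (w n - w i)) k.+1
    = series m k.+1 * w n - mw k.+1.
    rewrite /mw /series /= mulr_suml -sumrB; apply: eq_bigr => i _.
    by rewrite mulrBr.
  rewrite [mw n.+1]seriesSr -/mw.
  by ring.
rewrite big_split /= -mulr_sumr triangular_sum_exchange.
(* The left side is the growth of the variance term, namely [m n] times the sum over [i < n] of
   [m i * (g n - g i) ^+ 2]. The path bound applies to each summand when [m n] is positive. *)
have incr : m n * (series (fun i => m i * g i ^+ 2) n + g n ^+ 2 * series m n
   - 2 * g n * series (fun i => m i * g i) n) <=
   m n * \sum_(0 <= i < n) m i * (w n - w i) * \sum_(i <= k < n) c k.
  have [->|mn0] := eqVneq (m n) 0; first by rewrite !mul0r.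
  have mn_gt0 : 0 < m n by rewrite lt_def mn0 m_ge0.
  rewrite ler_pM2l //.
  have -> : series (fun i => m i * g i ^+ 2) n + g n ^+ 2 * series m n
    - 2 * g n * series (fun i => m i * g i) n =
    \sum_(0 <= i < n) m i * (g n - g i) ^+ 2.
    rewrite /series /= !mulr_sumr -big_split /= -sumrB.
    by apply: eq_bigr => i _; ring.
  apply: ler_sum_nat => i /andP[_ lt_in]; rewrite -mulrA.
  by rewrite ler_wpM2l // CS.
move: IH incr.
set F := \sum_(0 <= k < n) _; set G := \sum_(0 <= i < n) _ => IH incr.
by nra.
Qed.


(** * Limits and tails of weighted series *)

Lemma series_le_lim (m : nat -> R) (Z : R) n : (forall i, 0 <= m i) ->
  series m @ \oo --> Z -> series m n <= Z.
Proof.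
move=> m_ge0 mZ; rewrite -(cvg_lim (@Rhausdorff R) mZ).
apply: nondecreasing_cvgn_le; last by apply/cvg_ex; exists Z.
by apply/nondecreasing_seqP => i; rewrite seriesSr lerDl.
Qed.

Lemma head_sum_le (m w : nat -> R) k : (forall i, 0 <= m i) ->
  nondecreasing_seq w ->
  series (fun i => m i * w i) k.+1 <= w k * series m k.+1.
Proof.
move=> m_ge0 w_nd; rewrite /series /= mulr_sumr.
apply: ler_sum_nat => i /andP[_ ik]; rewrite mulrC ler_wpM2r //.
exact: w_nd.
Qed.

Lemma tail_sum_ge (m w : nat -> R) n (Z Psi : R) : (forall i, 0 <= m i) ->
  nondecreasing_seq w -> series m @ \oo --> Z ->
  series (fun i => m i * w i) @ \oo --> Psi ->
  w n * (Z - series m n) <= Psi - series (fun i => m i * w i) n.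
Proof.
move=> m_ge0 w_nd mZ mwPsi.
have l1 : (fun p => w n * (series m p - series m n)) @ \oo -->
    w n * (Z - series m n).
  by apply: cvgMl_tmp; apply: cvgB => //; exact: cvg_cst.
have l2 : (fun p => series (fun i => m i * w i) p
    - series (fun i => m i * w i) n) @ \oo -->
    Psi - series (fun i => m i * w i) n.
  by apply: cvgB => //; exact: cvg_cst.
apply: (ler_cvg_to l1 l2); near=> p.
have np : (n <= p)%N by near: p; exact: nbhs_infty_ge.
rewrite !sub_series_geq // mulr_sumr.
apply: ler_sum_nat => i /andP[ni _]; rewrite mulrC ler_wpM2l //.
exact: w_nd.
Unshelve. all: by end_near. Qed.

(** The gap is [S_(k+1) (Psi - W_n) - W_(k+1) (Z - S_n)]. It is nonnegative because [w] is at least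
    [w n] on the tail and at most [w k <= w n] on the head. *)
Lemma flow_le_limit (m w : nat -> R) k n (Z Psi : R) : (forall i, 0 <= m i) ->
  nondecreasing_seq w -> series m @ \oo --> Z ->
  series (fun i => m i * w i) @ \oo --> Psi -> (k < n)%N ->
  series m k.+1 * series (fun i => m i * w i) n
    - series (fun i => m i * w i) k.+1 * series m n <=
  series m k.+1 * Psi - series (fun i => m i * w i) k.+1 * Z.
Proof.
move=> m_ge0 w_nd mZ mwPsi kn.
have tail := tail_sum_ge n m_ge0 w_nd mZ mwPsi.
have head := head_sum_le k m_ge0 w_nd.
have wkn : w k <= w n by apply: w_nd; exact: ltnW.
have S_ge0 : 0 <= series m k.+1 by apply: sumr_ge0.
have tail_ge0 : 0 <= Z - series m n.
  by rewrite subr_ge0 series_le_lim.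
rewrite -subr_ge0.
have h1 := ler_wpM2l S_ge0 tail.
have h2 := ler_wpM2r tail_ge0 head.
have h3 := ler_wpM2r tail_ge0 (ler_wpM2r S_ge0 wkn).
by nra.
Qed.

(** Case [n = k.+1] of [flow_le_limit], where the finite flow is zero. *)
Lemma flow_limit_ge0 (m w : nat -> R) k (Z Psi : R) : (forall i, 0 <= m i) ->
  nondecreasing_seq w -> series m @ \oo --> Z ->
  series (fun i => m i * w i) @ \oo --> Psi ->
  0 <= series m k.+1 * Psi - series (fun i => m i * w i) k.+1 * Z.
Proof.
move=> m_ge0 w_nd mZ mwPsi.
have := flow_le_limit m_ge0 w_nd mZ mwPsi (ltnSn k).
by rewrite [X in X - _]mulrC subrr.
Qed.

(** Replacing the finite flows by their limits gives sums bounded by [K], so only the variance side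
    has to converge. *)
Lemma variance_le_flow_limit (m w g c : nat -> R) (Z Psi A B K : R) :
  (forall i, 0 <= m i) -> (forall i, 0 <= c i) -> nondecreasing_seq w ->
  (forall i j, (i < j)%N -> 0 < m j ->
    (g j - g i) ^+ 2 <= (w j - w i) * \sum_(i <= k < j) c k) ->
  series m @ \oo --> Z -> series (fun i => m i * w i) @ \oo --> Psi ->
  series (fun i => m i * g i ^+ 2) @ \oo --> A ->
  series (fun i => m i * g i) @ \oo --> B ->
  (forall n, \sum_(0 <= k < n) c k *
    (series m k.+1 * Psi - series (fun i => m i * w i) k.+1 * Z) <= K) ->
  Z * A - B ^+ 2 <= K.
Proof.
move=> m_ge0 c_ge0 w_nd CS mZ mwPsi mA mB bound.
have lim : (fun n => series m n * series (fun i => m i * g i ^+ 2) n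
    - series (fun i => m i * g i) n ^+ 2) @ \oo --> Z * A - B ^+ 2.
  apply: cvgB; first exact: cvgM.
  by rewrite expr2; under eq_fun do rewrite expr2; exact: cvgM.
apply: (cvgr_to_le lim); near=> n.
apply: (le_trans (variance_le_flow n m_ge0 CS)).
apply: le_trans (bound n); apply: ler_sum_nat => k /andP[_ kn].
by rewrite ler_wpM2l // flow_le_limit.
Unshelve. all: by end_near. Qed.

(* Summation by parts against the tails [M j = Z - series m j <= d / s j ^+ 2],
   using [(t - s) / t ^+ 2 <= s^-1 - t^-1] to telescope. *)
Lemma tail_weighted_sum_le (m s : nat -> R) (Z d : R) i n :
  (0 < i)%N -> (forall j, (0 < j)%N -> 0 < s j) -> nondecreasing_seq s ->
  (forall j, 0 <= Z - series m j) ->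
  (forall j, (0 < j)%N -> s j ^+ 2 * (Z - series m j) <= d) -> (i <= n)%N ->
  \sum_(i <= j < n) m j * s j <= 2 * d / s i.
Proof.
move=> i_gt0 s_gt0 s_nd M_ge0 Md le_in.
have d_ge0 : 0 <= d.
  by apply: le_trans (Md i i_gt0); rewrite mulr_ge0 ?sqr_ge0.
(* The boundary term at [n] and the slack [d / s n] make the bound inductive; both are dropped at
   the end. *)
suff inv : \sum_(i <= j < n) m j * s j + s n * (Z - series m n) <=
    2 * d / s i - d / s n.
  have sn_gt0 := s_gt0 n (leq_trans i_gt0 le_in).
  have h1 : 0 <= s n * (Z - series m n) by rewrite mulr_ge0 // ltW.
  have h2 : 0 <= d / s n by rewrite divr_ge0 // ltW.
  by lra.
elim: n le_in => [|n IH] le_in; first by move: (leq_trans i_gt0 le_in).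
have base j : (0 < j)%N -> s j * (Z - series m j) <= d / s j.
  move=> j0; rewrite ler_pdivlMr ?s_gt0 //; apply: le_trans (Md j j0).
  by rewrite expr2 mulrAC.
move: le_in; rewrite leq_eqVlt => /predU1P[<-|].
  rewrite big_geq // add0r; apply: (le_trans (base _ i_gt0)).
  by rewrite -mulrA mulr_natl mulr2n addrK.
rewrite ltnS => le_in; rewrite big_nat_recr //= seriesSr.
have n_gt0 := leq_trans i_gt0 le_in.
have {IH} := IH le_in.
have := Md n.+1 isT; rewrite seriesSr.
have := s_gt0 n n_gt0; have := s_gt0 n.+1 isT; have := s_nd _ _ (leqnSn n).
set M := Z - (series m n + m n); set x := s n; set y := s n.+1.
move=> xy y0 x0 Myd IH.
have step : (y - x) * M <= d / x - d / y.
  have -> : d / x - d / y = (y - x) * (d / (x * y)).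
    by field; rewrite !gt_eqF.
  rewrite ler_wpM2l ?subr_ge0 // ler_pdivlMr ?mulr_gt0 //.
  apply: le_trans Myd; rewrite mulrC expr2 ler_wpM2r ?ler_wpM2r //.
    by rewrite /M -seriesSr.
  exact: ltW.
have EM : Z - series m n = M + m n by rewrite /M; ring.
by move: IH; rewrite EM; nra.
Qed.

End Series.

(** * The measure [mu] and the function [phi] *)

Section BirthDeathChain.
Context {R : realType}.
Variables (N : option nat) (a b : nat -> R).
Hypotheses (N_ge1 : le_oo 1 N)
  (b_gt0 : forall i, lt_oo i N -> 0 < b i)
  (b_N : forall n, N = Some n -> b n = 0)
  (a_gt0 : forall i, (1 <= i)%N -> le_oo i N -> 0 < a i)
  (a_0 : a 0%N = 0).

Local Notation m := (mu a b).
Local Notation ph := (phi a b).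
Local Notation w := (fun i => Num.sqrt (phi a b i)).

Lemma le_oo_trans i j : (i <= j)%N -> le_oo j N -> le_oo i N.
Proof. by case: N => //= n; exact: leq_trans. Qed.

Lemma lt_ooE i : lt_oo i N = le_oo i.+1 N.
Proof. by case: N. Qed.

Lemma mu0E : m 0%N = 1.
Proof. by rewrite /mu !big_geq // divr1. Qed.

Lemma mu_gt0 i : le_oo i N -> 0 < m i.
Proof.
move=> iN; rewrite /mu divr_gt0 // big_seq prodr_gt0 // => j;
  rewrite mem_index_iota.
- by move=> /andP[_ ji]; apply: b_gt0; rewrite lt_ooE; exact: le_oo_trans iN.
- by move=> /andP[j1 ji]; apply: a_gt0 => //; exact: le_oo_trans iN.
Qed.

(** Past [N] the numerator contains the factor [b n = 0] with [N = Some n]. Hence sums over the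
    state space are sums over all of [nat]. *)
Lemma mu_out i : ~~ le_oo i N -> m i = 0.
Proof.
case: N b_N => // n /(_ n erefl) bn /=; rewrite -ltnNge => lt_ni.
rewrite /mu (big_cat_nat (n := n)) //= ?(ltnW lt_ni) //.
by rewrite (big_ltn lt_ni) bn mul0r mulr0 mul0r.
Qed.

Lemma mu_ge0 i : 0 <= m i.
Proof. by case: (boolP (le_oo i N)) => [/mu_gt0/ltW|/mu_out ->]. Qed.

(** Detailed balance: it converts the death-rate weights of [dirichlet] and [delta] into the
    birth-rate weights of [phi]. *)
Lemma mu_balance i : le_oo i.+1 N -> m i.+1 * a i.+1 = m i * b i.
Proof.
move=> iN; rewrite /mu [\prod_(0 <= j < i.+1) b j]big_nat_recr //=.
rewrite [\prod_(1 <= j < i.+2) a j]big_nat_recr //=.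
have a0 := a_gt0 (ltn0Sn i) iN.
have A0 : 0 < \prod_(1 <= j < i.+1) a j.
  rewrite big_seq prodr_gt0 // => j; rewrite mem_index_iota => /andP[j1 ji].
  by apply: a_gt0 => //; apply: le_oo_trans iN; exact: ltnW.
by field; rewrite !gt_eqF.
Qed.

Lemma phi0 : ph 0%N = 0.
Proof. by rewrite /phi big_geq. Qed.

Lemma phiS i : ph i.+1 = ph i + (m i * b i)^-1.
Proof. by rewrite /phi big_nat_recr. Qed.

Lemma mub_ge0 i : 0 <= m i * b i.
Proof.
case: (boolP (le_oo i N)) => [iN|/mu_out ->]; last by rewrite mul0r.
rewrite mulr_ge0 ?mu_ge0 //.
case: N b_gt0 b_N iN => [n|] bgt b_n /=; last by move=> _; exact/ltW/bgt.
rewrite leq_eqVlt => /predU1P[->|lt_in]; first by rewrite b_n.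
by rewrite ltW // bgt.
Qed.

(** This holds on all of [nat]: from [N] on, the increments are inverses of 0, which are 0 by
    convention. *)
Lemma phi_nd : nondecreasing_seq ph.
Proof.
by apply/nondecreasing_seqP => i; rewrite phiS lerDl invr_ge0 mub_ge0.
Qed.

Lemma phi_ge0 i : 0 <= ph i.
Proof. by rewrite -phi0; exact: phi_nd. Qed.

Lemma phi_incr i : le_oo i.+1 N -> (m i.+1 * a i.+1) * (ph i.+1 - ph i) = 1.
Proof.
move=> iN; rewrite phiS addrC addKr mu_balance // mulfV // -mu_balance //.
by rewrite gt_eqF // mulr_gt0 ?mu_gt0 // a_gt0.
Qed.

Lemma phi_gt0 i : (0 < i)%N -> 0 < ph i.
Proof.
move=> i0; apply: (lt_le_trans _ (phi_nd i0)).
rewrite lt_def phi_ge0 andbT; apply/eqP => p1.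
have := phi_incr N_ge1; rewrite p1 phi0 subrr mulr0 => /eqP.
by rewrite eq_sym oner_eq0.
Qed.

Lemma sum_inv_mu_a n : le_oo n N ->
  \sum_(1 <= i < n.+1) (m i * a i)^-1 = ph n.
Proof.
elim: n => [|n IH] nN; first by rewrite big_geq // phi0.
rewrite big_nat_recr //= IH; last exact: le_oo_trans nN.
by rewrite phiS mu_balance.
Qed.

Lemma sqrt_phi_nd : nondecreasing_seq w.
Proof. by move=> i j ij; rewrite ler_wsqrtr // phi_nd. Qed.

Lemma sqrt_phi_gt0 i : (0 < i)%N -> 0 < w i.
Proof. by move=> i0; rewrite sqrtr_gt0 phi_gt0. Qed.

(** The increment of [w] times [w k.+1 + w k] is the increment of [phi], which cancels the weight
    [m k.+1 * a k.+1] by [phi_incr]. Positivity of [m j] places the whole path in the state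
    space. *)
Lemma sqrt_phi_cauchy_schwarz (g : nat -> R) i j : (i < j)%N -> 0 < m j ->
  (g j - g i) ^+ 2 <= (w j - w i) *
    \sum_(i <= k < j) m k.+1 * a k.+1 * (g k.+1 - g k) ^+ 2 * (w k.+1 + w k).
Proof.
move=> ij mj; have jN : le_oo j N.
  by apply/negPn/negP => /mu_out jN; rewrite jN ltxx in mj.
apply: (cauchy_schwarz_telescope (w := w) (c := fun k =>
  m k.+1 * a k.+1 * (g k.+1 - g k) ^+ 2 * (w k.+1 + w k))); first exact: ltnW.
move=> k kj; have kN : le_oo k.+1 N by exact: le_oo_trans jN.
split; first exact: sqrt_phi_nd.
  apply: mulr_ge0; last by rewrite addr_ge0 ?sqrtr_ge0.
  by rewrite mulr_ge0 ?sqr_ge0 // mulr_ge0 ?mu_ge0 // ltW // a_gt0.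
have E : (w k.+1 - w k) * (w k.+1 + w k) = ph k.+1 - ph k.
  by rewrite -subr_sqr !sqr_sqrtr ?phi_ge0.
transitivity (m k.+1 * a k.+1 * (ph k.+1 - ph k) * (g k.+1 - g k) ^+ 2).
  by rewrite phi_incr // mul1r.
by rewrite -E; ring.
Qed.

(** * Finite total mass and the terms of [eta1] *)

Hypothesis mu_finite : (\sum_(0 <= i <oo | le_oo i N) (m i)%:E < +oo)%E.

Local Notation Z := (limn (series m)).
Local Notation mw := (fun i => m i * w i).

Lemma mu_cvg : series m @ \oo --> Z.
Proof. exact: (nneseries_lty_cvg mu_ge0 mu_out mu_finite). Qed.

Lemma tail_mu_ge0 n : 0 <= Z - series m n.
Proof. by rewrite subr_ge0; apply: series_le_lim; [exact: mu_ge0|exact: mu_cvg]. Qed.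

Lemma mu_total_gt0 : 0 < Z.
Proof.
have := tail_mu_ge0 1; rewrite subr_ge0 /series /= big_nat1 mu0E.
exact: lt_le_trans.
Qed.

Lemma mu_itvE p : mu_itv N a b p N = (Z - series m p)%:E.
Proof.
apply: eseries_EFin; last exact: mu_cvg.
by move=> i; rewrite andbb => /mu_out.
Qed.

Lemma mu_itv0E : mu_itv N a b 0 N = Z%:E.
Proof. by rewrite mu_itvE /series /= big_geq // subr0. Qed.

Lemma mu_itv0_invE : (mu_itv N a b 0 N)^-1%E = (Z^-1)%:E.
Proof. by rewrite mu_itv0E inver gt_eqF // mu_total_gt0. Qed.

Lemma mw_ge0 i : 0 <= mw i.
Proof. by rewrite mulr_ge0 ?mu_ge0 ?sqrtr_ge0. Qed.

Lemma mw_out i : ~~ le_oo i N -> mw i = 0.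
Proof. by move=> /mu_out ->; rewrite mul0r. Qed.

Lemma series_mw1 : series mw 1 = 0.
Proof. by rewrite /series /= big_nat1 phi0 sqrtr0 mulr0. Qed.

Lemma psiE i : cvgn (series mw) ->
  psi N a b i = (limn (series mw) - series mw i)%:E.
Proof. by move=> cv; apply: eseries_EFin => // j /mw_out. Qed.

Lemma psi1_lty : (psi N a b 1 < +oo)%E <-> cvgn (series mw).
Proof.
split; first by move/(nneseries_lty_cvg mw_ge0 mw_out).
by move/psiE => ->; rewrite ltry.
Qed.

Lemma eta1_termE k : cvgn (series mw) ->
  ((Num.sqrt (ph k.+1) + Num.sqrt (ph k.+1.-1))%:E *
    (psi N a b k.+1 -
     psi N a b 1 * (mu_itv N a b k.+1 N / mu_itv N a b 0 N)))%E =
  ((w k.+1 + w k) *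
    (series m k.+1 * limn (series mw) - series mw k.+1 * Z) / Z)%:E.
Proof.
(* The term of index 0 vanishes because [phi] is 0 there, so [psi 1] is the full sum. *)
move=> cv; rewrite !psiE // mu_itv0_invE mu_itvE series_mw1 subr0.
rewrite -!EFinM; congr EFin => /=.
have := mu_total_gt0; set z := Z; set P := limn (series mw) => z0.
by field; rewrite gt_eqF.
Qed.

Lemma eta1_flow_ge0 k : cvgn (series mw) ->
  0 <= series m k.+1 * limn (series mw) - series mw k.+1 * Z.
Proof.
move=> cv; apply: flow_limit_ge0 => //; [exact: mu_ge0 | exact: sqrt_phi_nd |].
exact: mu_cvg.
Qed.

Lemma E1_succ k : E1 N k.+1 <-> le_oo k.+1 N.
Proof. by split=> [[]|kN]//; split. Qed.

Lemma eta1_ub k : cvgn (series mw) -> le_oo k.+1 N ->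
  (((w k.+1 + w k) *
    (series m k.+1 * limn (series mw) - series mw k.+1 * Z) / Z)%:E
   <= eta1 N a b)%E.
Proof.
move=> cv kN; rewrite /eta1 lt_eqF; last exact/psi1_lty.
by apply: ereal_sup_ubound; exists k.+1; [exact/E1_succ | exact: eta1_termE].
Qed.

Lemma eta1_ge0 : (0 <= eta1 N a b)%E.
Proof.
have [cv|ncv] := pselect (cvgn (series mw)); last first.
  by rewrite /eta1; case: eqP => // /eqP; rewrite -ltey => /psi1_lty.
apply: (le_trans _ (eta1_ub cv N_ge1)); rewrite lee_fin divr_ge0 //.
  by apply: mulr_ge0; [rewrite addr_ge0 ?sqrtr_ge0 | exact: eta1_flow_ge0].
exact/ltW/mu_total_gt0.
Qed.

(** * Comparison of [eta1] with [delta] *)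

Lemma delta_ub n : E1 N n -> ((ph n * (Z - series m n))%:E <= delta N a b)%E.
Proof.
move=> En; apply: ereal_sup_ubound; exists n => //.
by case: En => _ nN; rewrite mu_itvE sum_inv_mu_a.
Qed.

Lemma tail_mu_out n : ~~ le_oo n N -> Z - series m n = 0.
Proof.
move=> nN; apply/eqP; rewrite subr_eq0; apply/eqP/cvg_lim => //.
apply: cvg_near_cst; near=> p; have np : (n <= p)%N.
  by near: p; exact: nbhs_infty_ge.
apply/eqP; rewrite eq_sym -subr_eq0 -opprB oppr_eq0 sub_series_geq //; apply/eqP.
rewrite big_nat_cond big1 // => i /andP[/andP[ni _] _]; apply: mu_out.
by apply: contra nN; exact: le_oo_trans.
Unshelve. all: by end_near. Qed.

Lemma eta1_le_delta : (eta1 N a b <= 4%:E * delta N a b)%E.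
Proof.
have d_ge0 : (0 <= delta N a b)%E.
  have E11 : E1 N 1 by exact/E1_succ.
  apply: (le_trans _ (delta_ub E11)).
  by rewrite lee_fin mulr_ge0 ?phi_ge0 ?tail_mu_ge0.
case D : (delta N a b) d_ge0 => [d| |] //; last first.
  by move=> _; rewrite gt0_muley ?leey // lte_fin.
rewrite lee_fin => d_ge0.
(* The bound is needed at every positive index; outside the state space the tail mass is zero. *)
have tail j : (0 < j)%N -> w j ^+ 2 * (Z - series m j) <= d.
  move=> j0; rewrite sqr_sqrtr ?phi_ge0 //.
  case: (boolP (le_oo j N)) => [jN|/tail_mu_out ->]; last by rewrite mulr0.
  by rewrite -lee_fin -D; apply: delta_ub.
have bound i n : (0 < i)%N -> (i <= n)%N ->
    \sum_(i <= j < n) m j * w j <= 2 * d / w i.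
  move=> i0; apply: (tail_weighted_sum_le i0 _ _ _ tail).
  - exact: sqrt_phi_gt0.
  - exact: sqrt_phi_nd.
  - exact: tail_mu_ge0.
(* The bound is uniform in [n], so finiteness of [delta] excludes the case where [eta1] is infinite
   by convention. *)
have cv : cvgn (series mw).
  apply: nondecreasing_is_cvgn.
    by apply/nondecreasing_seqP => i; rewrite seriesSr lerDl mw_ge0.
  exists (2 * d / w 1%N) => _ [[|n] _ <-].
    rewrite /series /= big_geq // divr_ge0 ?sqrtr_ge0 // mulr_ge0 //.
  have := bound 1%N n.+1 isT isT.
  by rewrite -sub_series_geq // series_mw1 subr0.
have psi_le i : (0 < i)%N -> limn (series mw) - series mw i <= 2 * d / w i.
  move=> i0; rewrite lerBlDr.
  apply: (cvgr_to_le cv); near=> n; rewrite -lerBlDr.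
  have le_in : (i <= n)%N by near: n; exact: nbhs_infty_ge.
  by rewrite sub_series_geq // bound.
rewrite /eta1 lt_eqF; last exact/psi1_lty.
apply: ge_ereal_sup => _ [[|k] [//= _ kN] <-].
rewrite eta1_termE // -EFinM lee_fin.
have w1 := sqrt_phi_gt0 (ltn0Sn k).
have wle := sqrt_phi_nd (leqnSn k).
have P_ge0 : 0 <= limn (series mw).
  have := series_le_lim 0 mw_ge0 cv; by rewrite /series /= big_geq.
have Z0 := mu_total_gt0.
(* Since [series m k.+1 <= Z], the quotient is at most the tail [psi k.+1]. *)
have h0 : (series m k.+1 * limn (series mw) - series mw k.+1 * Z) / Z <=
    2 * d / w k.+1.
  apply: le_trans (psi_le _ (ltn0Sn k)).
  rewrite mulrBl mulfK ?gt_eqF // lerD2r ler_pdivrMr // mulrC ler_wpM2l //.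
  by rewrite -subr_ge0 tail_mu_ge0.
have h1 : 0 <= (series m k.+1 * limn (series mw) - series mw k.+1 * Z) / Z.
  by apply: divr_ge0; [exact: eta1_flow_ge0 | exact: ltW].
(* The constant 4 is the 2 from the tail bound times the 2 from [w k <= w k.+1]. *)
rewrite -mulrA; apply: (@le_trans _ _ ((w k.+1 + w k.+1) * (2 * d / w k.+1))).
  by apply: ler_pM => //; rewrite lerD2l.
rewrite le_eqVlt; apply/orP; left; apply/eqP.
by move: w1; set y := Num.sqrt _ => y0; field; rewrite gt_eqF.
Unshelve. all: by end_near. Qed.

(** * Lower bound for [lambda1] *)

Local Notation energy f := (fun i => m i * a i * (f i - f i.-1) ^+ 2).

Lemma energy_ge0 (f : nat -> R) i : 0 <= energy f i.
Proof.
rewrite mulr_ge0 ?sqr_ge0 //; case: i => [|i]; first by rewrite a_0 mulr0.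
case: (boolP (le_oo i.+1 N)) => [iN|/mu_out ->]; last by rewrite mul0r.
by rewrite mulr_ge0 ?mu_ge0 // ltW // a_gt0.
Qed.

Lemma energy_out (f : nat -> R) i : ~~ le_oo i N -> energy f i = 0.
Proof. by move=> /mu_out ->; rewrite !mul0r. Qed.

Lemma energy0 (f : nat -> R) : energy f 0%N = 0.
Proof. by rewrite /= a_0 mulr0 mul0r. Qed.

Lemma mul_mu_out (f : nat -> R) i : ~~ le_oo i N -> m i * f i = 0.
Proof. by move=> /mu_out ->; rewrite mul0r. Qed.

Lemma dirichletE (f : nat -> R) (s : R) : series (energy f) @ \oo --> s ->
  dirichlet N a b f = s%:E.
Proof.
move=> cv; rewrite -[s]subr0 -[X in s - X](energy0 f).
rewrite [X in s - X](_ : _ = series (energy f) 1); last first.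
  by rewrite /series /= big_nat1.
by apply: eseries_EFin cv; exact: energy_out.
Qed.

Lemma mu_funE (f : nat -> R) (s : R) :
  series (fun i => m i * f i) @ \oo --> s -> mu_fun N a b f = s%:E.
Proof.
move=> cv; rewrite -[s]subr0 -[X in s - X](_ : series (fun i => m i * f i) 0 = 0).
  by apply: eseries_EFin cv; exact: mul_mu_out.
by rewrite /series /= big_geq.
Qed.

Lemma mu_fun_sqr_cvg (f : nat -> R) :
  (mu_fun N a b (fun i => (f i ^+ 2)%R) < +oo)%E ->
  cvgn (series (fun i => m i * f i ^+ 2)).
Proof.
apply: nneseries_lty_cvg => i; last exact: (mul_mu_out (fun i => f i ^+ 2)).
by rewrite mulr_ge0 ?mu_ge0 ?sqr_ge0.
Qed.

(** Absolute convergence follows from [|f| <= 1 + f^2] and the finiteness of [mu]. *)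
Lemma mu_fun_cvg (f : nat -> R) :
  (mu_fun N a b (fun i => (f i ^+ 2)%R) < +oo)%E ->
  cvgn (series (fun i => m i * f i)).
Proof.
move=> /mu_fun_sqr_cvg cv2; apply: normed_cvg.
apply: (@series_le_cvg _ _ (fun i => m i + m i * f i ^+ 2)).
- by move=> i; exact: normr_ge0.
- move=> i; apply: addr_ge0; first exact: mu_ge0.
  by apply: mulr_ge0; [exact: mu_ge0 | exact: sqr_ge0].
- move=> i /=; rewrite normrM ger0_norm ?mu_ge0 //.
  rewrite -[X in X + _]mulr1 -mulrDr ler_wpM2l ?mu_ge0 //.
  have := sqr_ge0 (`|f i| - 1); rewrite sqrrB expr1n mulr1 real_normK ?num_real //.
  have := normr_ge0 (f i); by lra.
- by apply: (@is_cvg_seriesD _ m) => //; apply/cvg_ex; exists Z; exact: mu_cvg.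
Qed.

Lemma eta1_inv_le_lambda1 : ((eta1 N a b)^-1 <= lambda1 N a b)%E.
Proof.
apply: le_ereal_inf_tmp => _ [f [[f2 Df] mf mf2] <-].
have cvD := nneseries_lty_cvg (energy_ge0 f) (@energy_out f) Df.
rewrite (dirichletE cvD).
have D_ge0 : 0 <= limn (series (energy f)).
  have := series_le_lim 0 (energy_ge0 f) cvD; by rewrite /series /= big_geq.
(* If [eta1] is infinite its inverse is 0, and nonnegativity of the energy suffices. *)
case E : (eta1 N a b) eta1_ge0 => [e| |] // e_ge0.
have cvw : cvgn (series mw).
  apply/psi1_lty; move: E; rewrite /eta1; case: eqP => // /eqP.
  by rewrite -ltey.
have cf2 := mu_fun_sqr_cvg f2.
have cf := mu_fun_cvg f2.
have E2 : limn (series (fun i => m i * f i ^+ 2)) = 1.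
  by have := mu_funE (f := fun i => f i ^+ 2) cf2; rewrite mf2 => -[].
have E1 : limn (series (fun i => m i * f i)) = 0.
  by have := mu_funE cf; rewrite mf => -[].
have Z0 := mu_total_gt0.
set Dl := limn (series (energy f)) in D_ge0 *.
(* The variance inequality with [mu(f^2) = 1] and [mu(f) = 0]; each flow is controlled by its term
   of [eta1], hence by [Z * e]. *)
have key : Z * 1 - 0 ^+ 2 <= Z * (e * Dl).
  rewrite -[in X in X <= _]E1 -[in X in X <= _]E2.
  apply: (variance_le_flow_limit (w := w) (c := fun k =>
    m k.+1 * a k.+1 * (f k.+1 - f k) ^+ 2 * (w k.+1 + w k)) mu_ge0 _
    sqrt_phi_nd _ mu_cvg cvw cf2 cf).
  - move=> k; apply: mulr_ge0; first exact: (energy_ge0 f k.+1).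
    by rewrite addr_ge0 ?sqrtr_ge0.
  - by move=> i j ij mj; exact: sqrt_phi_cauchy_schwarz.
  move=> n; apply: (@le_trans _ _ (\sum_(0 <= k < n) Z * e * energy f k.+1)).
    apply: ler_sum_nat => k _.
    case: (boolP (le_oo k.+1 N)) => [kN|/mu_out ->]; last by rewrite !mul0r mulr0.
    have := eta1_ub cvw kN; rewrite E lee_fin ler_pdivrMr // => h.
    by rewrite -mulrA [X in _ <= X]mulrC [Z * e]mulrC ler_wpM2l // (energy_ge0 f k.+1).
  rewrite -mulr_sumr -mulrA ler_wpM2l ?(ltW Z0) // ler_wpM2l //.
  apply: le_trans (series_le_lim n.+1 (energy_ge0 f) cvD).
  by rewrite /series /= big_nat_recl //= energy0 add0r.
move: key; rewrite mulr1 expr0n subr0 -[X in X <= _]mulr1 ler_pM2l // => key.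
(* [key] now reads [1 <= e * Dl], which rules out [e = 0]. *)
have e_gt0 : 0 < e.
  rewrite lt_def -lee_fin e_ge0 andbT; apply/eqP => e0.
  by move: key; rewrite e0 mul0r ler10.
by rewrite inver gt_eqF // lee_fin -[X in X <= _]mul1r ler_pdivrMr // mulrC.
Qed.

(** * Stopped functions, [etabar1] and the upper bound *)

Local Notation Q h n :=
  (series (fun k => m k * h k) n + h n * (Z - series m n)).

(** The stopped function is constant from [n] on, so [Q h n] is its integral: head sum plus [h n]
    times the tail mass. *)
Lemma stopped_series_cvg (h : nat -> R) n :
  series (fun k => m k * h (minn k n)) @ \oo --> Q h n.
Proof.
have : (fun p => series (fun k => m k * h k) n + h n * (series m p - series m n))
    @ \oo --> Q h n.
  apply: cvgD; first exact: cvg_cst.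
  by apply: cvgMl_tmp; apply: cvgB; [exact: mu_cvg | exact: cvg_cst].
apply: cvg_trans; apply: near_eq_cvg; near=> p.
have np : (n <= p)%N by near: p; exact: nbhs_infty_ge.
rewrite sub_series_geq // mulr_sumr /series /= [RHS](big_cat_nat (n := n)) //=.
congr (_ + _); apply: eq_big_nat => k /andP[].
- by move=> _ /ltnW/minn_idPl ->.
- by move=> /minn_idPr -> _; rewrite mulrC.
Unshelve. all: by end_near. Qed.

Lemma mu_itv_headE n : E1 N n -> mu_itv N a b 0 (Some n.-1) = (series m n)%:E.
Proof.
case=> n1 nN; rewrite /mu_itv.
(* The sequence is cut at [n] so that it vanishes off the summation range, as [eseries_EFin]
   demands. *)
rewrite (eq_eseriesr (g := fun i => (if (i < n)%N then m i else 0)%:E));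
  last first.
  by move=> i /andP[_ /=]; rewrite -ltnS prednK // => ->.
rewrite (@eseries_EFin _ _ _ _ (series m n)).
- by rewrite [X in _ - X]/series /= big_geq // subr0.
- move=> i; case: ifPn => // lt_in; rewrite negb_and => /orP[/mu_out //|].
  by rewrite /= -ltnS prednK // lt_in.
apply: cvg_near_cst; near=> p; have np : (n <= p)%N.
  by near: p; exact: nbhs_infty_ge.
by rewrite /series /= (big_nat_widen _ _ _ _ _ np) -big_mkcond.
Unshelve. all: by end_near. Qed.

(** The integral of the squared deviation of the stopped [phi] from its mean, with [mu] not
    normalized. *)
Definition stopped_variance n := Q (fun k => ph k ^+ 2) n - Q ph n ^+ 2 / Z.

Lemma etabar1_termE n :
  ((ph n)^-1%:E *
      ((\sum_(1 <= k <oo | le_oo k N) (m k * ph (minn k n) ^+ 2)%:E)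
       - (mu_itv N a b 0 N)^-1 *
         (\sum_(1 <= k <oo | le_oo k N) (m k * ph (minn k n))%:E) ^+ 2))%E
  = ((ph n)^-1 * stopped_variance n)%:E.
Proof.
rewrite (eseries_EFin 1 _ (@stopped_series_cvg (fun k => ph k ^+ 2) n)); last first.
  by move=> i /mu_out ->; rewrite mul0r.
rewrite (eseries_EFin 1 _ (@stopped_series_cvg ph n)); last first.
  by move=> i /mu_out ->; rewrite mul0r.
rewrite mu_itv0_invE /series /= !big_nat1 min0n phi0 expr0n /= !mulr0 !subr0.
by rewrite -!EFinM; congr EFin; rewrite /stopped_variance [_ / Z]mulrC.
Qed.

(** Expand both integrals into head and tail, then use that head mass and tail mass add up to
    [Z]. *)
Lemma etabar1_explicit_termE n : E1 N n ->
  ((ph n)^-1%:E *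
      ((\sum_(1 <= k < n) m k * ph k ^+ 2)%:E
       - (mu_itv N a b 0 N)^-1 * ((\sum_(1 <= k < n) m k * ph k) ^+ 2)%:E)
      + mu_itv N a b n N / mu_itv N a b 0 N *
        ((ph n)%:E * mu_itv N a b 0 (Some n.-1)
         - (2 * \sum_(1 <= k < n) m k * ph k)%:E))%E
  = ((ph n)^-1 * stopped_variance n)%:E.
Proof.
move=> En; have n1 : (0 < n)%N by case: En.
rewrite mu_itv0_invE mu_itvE mu_itv_headE //.
have head (h : nat -> R) : h 0%N = 0 ->
    \sum_(1 <= k < n) m k * h k = series (fun k => m k * h k) n.
  by move=> h0; rewrite /series /= [RHS]big_ltn // h0 mulr0 add0r.
rewrite (head (fun k => ph k ^+ 2)) ?phi0 ?expr0n // (head ph) ?phi0 //.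
congr EFin; rewrite /stopped_variance.
have := mu_total_gt0; have := phi_gt0 n1.
set z := Z => p0 z0; field.
by rewrite !gt_eqF.
Qed.

Lemma etabar1E : etabar1 N a b = etabar1_explicit N a b.
Proof.
rewrite /etabar1 /etabar1_explicit; congr ereal_sup.
apply: eq_imagel => n En.
by rewrite etabar1_termE etabar1_explicit_termE.
Qed.

(** The mean [c] is positive because [phi 1] is, while [phi] is 0 at 0, where the mass is 1. That
    point alone contributes [c ^+ 2]. *)
Lemma stopped_variance_gt0 n : (0 < n)%N -> 0 < stopped_variance n.
Proof.
move=> n1; pose c := Q ph n / Z.
have Z0 := mu_total_gt0.
have EV : stopped_variance n = Q (fun k => (ph k - c) ^+ 2) n.
  have -> : series (fun k => m k * (ph k - c) ^+ 2) n =
      series (fun k => m k * ph k ^+ 2) n - 2 * c * series (fun k => m k * ph k) n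
      + c ^+ 2 * series m n.
    rewrite /series /= !mulr_sumr -sumrB -big_split /=.
    by apply: eq_bigr => k _; ring.
  rewrite /stopped_variance /c; move: Z0; set z := Z => z0.
  by field; rewrite gt_eqF.
have c_gt0 : 0 < c.
  rewrite divr_gt0 //.
  have p0 : 0 < m 1%N * ph 1%N by rewrite mulr_gt0 ?phi_gt0 ?mu_gt0.
  apply: (lt_le_trans p0); apply: (cvgr_to_ge (@stopped_series_cvg ph n)).
  near=> p; have p2 : (2 <= p)%N by near: p; exact: nbhs_infty_ge.
  rewrite /series /= big_ltn ?(ltnW p2) // big_ltn // (minn_idPl n1).
  rewrite addrCA lerDl; apply: addr_ge0; last apply: sumr_ge0 => k _.
  - by rewrite mulr_ge0 ?phi_ge0 ?mu_ge0.
  - by rewrite mulr_ge0 ?phi_ge0 ?mu_ge0.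
rewrite EV; apply: (@lt_le_trans _ _ (c ^+ 2)); first exact: exprn_gt0.
apply: (cvgr_to_ge (@stopped_series_cvg (fun k => (ph k - c) ^+ 2) n)).
near=> p; have p1 : (1 <= p)%N by near: p; exact: nbhs_infty_ge.
rewrite /series /= big_ltn // min0n phi0 mu0E mul1r sub0r sqrrN lerDl.
by apply: sumr_ge0 => k _; rewrite mulr_ge0 ?sqr_ge0 ?mu_ge0.
Unshelve. all: by end_near. Qed.

Lemma lambda1_le_stopped n : E1 N n ->
  (lambda1 N a b <= (ph n / stopped_variance n)%:E)%E.
Proof.
move=> [n1 nN]; have V0 := stopped_variance_gt0 n1; have Z0 := mu_total_gt0.
set V := stopped_variance n in V0 *.
have EV : V = Q (fun k => ph k ^+ 2) n - Q ph n ^+ 2 / Z by [].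
(* Subtracting the mean [c] gives integral 0; dividing by [Num.sqrt V] gives square integral 1. *)
pose c := Q ph n / Z; pose h k := (ph k - c) / Num.sqrt V.
have sV : Num.sqrt V ^+ 2 = V by rewrite sqr_sqrtr // ltW.
have sV0 : 0 < Num.sqrt V by rewrite sqrtr_gt0.
have hsq k : h k ^+ 2 = (ph k - c) ^+ 2 / V by rewrite /h expr_div_n sV.
pose f k := h (minn k n).
have mf : mu_fun N a b f = 0%E.
  rewrite (mu_funE (@stopped_series_cvg h n)); congr EFin.
  have -> : series (fun k => m k * h k) n =
      (series (fun k => m k * ph k) n - c * series m n) / Num.sqrt V.
    rewrite /series /= mulr_sumr -sumrB mulr_suml.
    by apply: eq_bigr => k _; rewrite /h; ring.
  rewrite /h /c; move: Z0; set z := Z => z0.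
  by field; rewrite !gt_eqF.
have mf2 : mu_fun N a b (fun i => (f i ^+ 2)%R) = 1%E.
  rewrite (mu_funE (@stopped_series_cvg (fun k => h k ^+ 2) n)); congr EFin.
  have -> : series (fun k => m k * h k ^+ 2) n =
      (series (fun k => m k * ph k ^+ 2) n - 2 * c * series (fun k => m k * ph k) n
      + c ^+ 2 * series m n) / V.
    rewrite /series /= !mulr_sumr -sumrB -big_split /= mulr_suml.
    apply: eq_bigr => k _; rewrite hsq; ring.
  rewrite hsq -[RHS](mulfV (lt0r_neq0 V0)).
  rewrite [X in _ = X / _]EV /c; move: Z0; set z := Z => z0.
  by field; rewrite !gt_eqF.
have Df : dirichlet N a b f = (ph n / V)%:E.
  apply: dirichletE.
  (* By [phi_incr] each edge up to [n] contributes the increment of [phi] over [V], and later edges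
     contribute nothing, so the energy telescopes. *)
  have E p : series (energy f) p.+1 = ph (minn p n) / V.
    elim: p => [|p IH].
      by rewrite /series /= big_nat1 energy0 min0n phi0 mul0r.
    rewrite seriesSr IH /= /f /h.
    have [pn|np] := ltnP p n; last first.
      rewrite (minn_idPr (leq_trans np (leqnSn p))).
      by rewrite subrr expr0n mulr0 addr0.
    rewrite (minn_idPl pn).
    have := phi_incr (le_oo_trans pn nN).
    rewrite -mulrBl expr_div_n sV opprD addrACA opprK addNr addr0.
    rewrite expr2 !mulrA => ->; rewrite mul1r -mulrDl; congr (_ / _).
    by rewrite subrKC.
  apply: cvg_near_cst; near=> p; have np : (n < p)%N.
    by near: p; exact: nbhs_infty_gt.
  rewrite -(prednK (leq_trans _ np)) // E (minn_idPr _) //.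
  by rewrite -ltnS prednK // (leq_trans _ np).
apply: ereal_inf_lbound; exists f => //; split => //; split.
- by rewrite mf2 ltry.
- by rewrite Df ltry.
Unshelve. all: by end_near. Qed.

(** Each term of the supremum is at most the inverse of [lambda1]. Bounding the supremum before
    inverting also covers an infinite [etabar1]. *)
Lemma lambda1_le_etabar1_inv : (lambda1 N a b <= (etabar1 N a b)^-1)%E.
Proof.
have l_ge0 : (0 <= lambda1 N a b)%E.
  by apply: le_trans eta1_inv_le_lambda1; rewrite inve_ge0 eta1_ge0.
have term_le n : E1 N n ->
    (((ph n)^-1 * stopped_variance n)%:E <= (lambda1 N a b)^-1)%E.
  move=> En; have n1 : (0 < n)%N by case: En.
  have V0 := stopped_variance_gt0 n1; have p0 := phi_gt0 n1.
  have t0 : 0 < (ph n)^-1 * stopped_variance n by rewrite mulr_gt0 ?invr_gt0.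
  rewrite inve_pge ?inE ?lee_fin ?(ltW t0) // inver gt_eqF // invfM invrK.
  exact: lambda1_le_stopped.
have b_ge0 : (0 <= etabar1 N a b)%E.
  have E11 : E1 N 1 by exact/E1_succ.
  apply: (@le_trans _ _ ((ph 1%N)^-1 * stopped_variance 1)%:E).
    by rewrite lee_fin mulr_ge0 ?invr_ge0 ?phi_ge0 // ltW // stopped_variance_gt0.
  by apply: ereal_sup_ubound; exists 1%N => //; exact: etabar1_termE.
rewrite inve_pge ?inE //; apply: ge_ereal_sup => _ [n En <-].
by rewrite etabar1_termE; exact: term_le.
Qed.

Lemma delta_inv_le_eta1_inv :
  ((4%:E * delta N a b)^-1 <= (eta1 N a b)^-1)%E.
Proof.
rewrite lee_pV2 ?inE ?eta1_ge0 ?eta1_le_delta //.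
by apply: le_trans eta1_le_delta; exact: eta1_ge0.
Qed.

End BirthDeathChain.

Local Open Scope ereal_scope.

Theorem corollary6p4 (R : realType) (N : option nat) (a b : nat -> R)
  (N_ge1 : le_oo 1 N)
  (b_gt0 : forall i : nat, lt_oo i N -> (0 < b i)%R)
  (b_N : forall n : nat, N = Some n -> b n = 0%R)
  (a_gt0 : forall i : nat, (1 <= i)%N -> le_oo i N -> (0 < a i)%R)
  (a_0 : a 0%N = 0%R)
  (mu_finite : \sum_(0 <= i <oo | le_oo i N) (mu a b i)%:E < +oo) :
  [/\ (4%:E * delta N a b)^-1 <= (eta1 N a b)^-1,
      (eta1 N a b)^-1 <= lambda1 N a b,
      lambda1 N a b <= (etabar1 N a b)^-1
    & etabar1 N a b = etabar1_explicit N a b].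
Proof.
split.
- exact: delta_inv_le_eta1_inv.
- exact: eta1_inv_le_lambda1.
- exact: lambda1_le_etabar1_inv.
- exact: etabar1E.
Qed.
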